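(* Let $T$ be a finite pure rooted tree with set of leaves $L$ and set of inner nodes $I$. Let $\{w_E\}_{E\subseteq L}$ be a probability distribution on the power set $2^L$, and let $P_w$ be the transition matrix of the induced random walk on the set $\mathcal{O}(T)$ of local orderings of $T$, that is, $$P_w(\pi,\pi')=\sum_{E\subseteq L\,:\,E(\pi)=\pi'} w_E\qquad\text{for }\pi,\pi'\in\mathcal{O}(T).$$ Then: (i) The matrix $P_w$ is diagonalizable (over $\mathbb{R}$). (ii) For each $\alpha=(\alpha_x)_{x\in I}\in\mathrm{Part}(T)$ there is an eigenvalue $$\varepsilon_\alpha=\sum_{E\subseteq L\,:\,E\text{ is }\alpha\text{-compatible}} w_E .$$ (iii) The multiplicity of the eigenvalue $\varepsilon_\alpha$ is $$m_\alpha=\prod_{x\in I}\ \prod_{B\in\alpha_x}(|B|-1)!.$$ (iv) These are all the eigenvalues of $P_w$. Here eigenvalues are indexed by $\alpha\in\mathrm{Part}(T)$, and both $\varepsilon_\alpha=\varepsilon_\beta$ for $\alpha\neq\beta$ and $\varepsilon_\alpha=0$ are possible; when several indices give the same number, their multiplicities add. That is, for every real number $\lambda$, the multiplicity of $\lambda$ as an eigenvalue of $P_w$ is $\sum_{\alpha\in\mathrm{Part}(T)\,:\,\varepsilon_\alpha=\lambda} m_\alpha$ (with multiplicity $0$ meaning that $\lambda$ is not an eigenvalue), and $P_w$ has no other eigenvalues.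
   Context: A finite rooted tree $T$ is *pure* if all its leaves are at the same depth $d$ (distance from the root). $L$ denotes the set of leaves (the nodes at depth $d$), and $I$ the set of inner nodes (the nodes at depths $0,\dots,d-1$). For $x\in I$, $C_x$ denotes the set of children of $x$. For $E\subseteq L$, a node $x$ of $T$ is *$E$-related* if some descendant of $x$ belongs to $E$. Every node counts as a descendant of itself, so a leaf is $E$-related if and only if it lies in $E$. A *local ordering* of $T$ is a family $\pi=(\pi_x)_{x\in I}$ where $\pi_x$ is a linear ordering of $C_x$ for each $x\in I$. $\mathcal{O}(T)$ is the set of all local orderings of $T$. Action of subsets of $L$ on local orderings: for $E\subseteq L$ and $\pi=(\pi_x)_{x\in I}\in\mathcal{O}(T)$, put $E(\pi)=(E_x(\pi_x))_{x\in I}$, where $E_x(\pi_x)$ is the linear ordering of $C_x$ in which the $E$-related elements of $C_x$ come first, in the order induced by $\pi_x$, followed by the remaining elements of $C_x$, also in the order induced by $\pi_x$. The random walk induced by $(w_E)_{E\subseteq L}$: if the walk is currently at the local ordering $\pi$, choose $E\subseteq L$ with probability $w_E$ and move to $E(\pi)$. $\mathrm{Part}(T)=\prod_{x\in I}\Pi(C_x)$, where $\Pi(A)$ is the set of all set partitions of a finite set $A$ (into nonempty blocks). So an element $\alpha=(\alpha_x)_{x\in I}$ is a choice of a partition $\alpha_x$ of $C_x$ for each $x\in I$. For $E\subseteq L$ and $x\in I$, let $\alpha^E_x$ be the partition of $C_x$ into two blocks, one consisting of the $E$-related elements of $C_x$ and the other of the remaining elements of $C_x$; if one of these is empty it is omitted,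 so that $\alpha^E_x$ then has a single block. For $\alpha\in\mathrm{Part}(T)$, a subset $E\subseteq L$ is *$\alpha$-compatible* if for every $x\in I$ the partition $\alpha_x$ is a refinement of $\alpha^E_x$ (every block of $\alpha^E_x$ is a union of blocks of $\alpha_x$; equality is allowed). *)

(* Defs.v *)
From HB Require Import structures.
From mathcomp Require Import all_boot all_order all_algebra.
From mathcomp Require Import reals.

Set Implicit Arguments.
Unset Strict Implicit.
Unset Printing Implicit Defensive.

Import GRing.Theory Num.Theory.

(* A finite rooted tree is given by its parent map; the value [root] of
   [parent] at the root is a dummy and does not make the root its own child. *)
Record rooted_tree := RootedTree {
  node :> finType;
  root : node;
  parent : node -> node;
  parent_root : parent root = root;
  root_ancestor : forall x : node, exists k, iter k parent x == root
}.

Definition depth (T : rooted_tree) (x : T) : nat := ex_minn (root_ancestor x).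

Definition children (T : rooted_tree) (x : T) : {set T} :=
  [set y | (y != root T) && (parent y == x)].

(* [y] is a descendant of [x]; every node is a descendant of itself. *)
Definition descendant (T : rooted_tree) (x y : T) : bool :=
  fconnect (@parent T) y x.

Definition leaves (T : rooted_tree) : {set T} := [set x | children x == set0].

Definition inner (T : rooted_tree) : finType := {x : T | x \notin leaves T}.

Definition pure_of_depth (T : rooted_tree) (d : nat) : Prop :=
  forall x : T, x \in leaves T -> depth x = d.

Definition pure (T : rooted_tree) : Prop := exists d, pure_of_depth T d.

Definition related (T : rooted_tree) (E : {set T}) (x : T) : bool :=
  [exists y in E, descendant x y].

Section LinearOrders.
Variable V : finType.
Implicit Types (A S : {set V}) (r : {set V * V}).

(* [r] is the graph of a (reflexive) linear order on [A]:
   [(a, b) \in r] means that [a] comes before [b] or equals it. *)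
Definition linear_order A r : bool :=
  [&& r \subset setX A A,
      [forall a in A, forall b in A, ((a, b) \in r) || ((b, a) \in r)],
      [forall a, forall b, ((a, b) \in r) && ((b, a) \in r) ==> (a == b)] &
      [forall a, forall b, forall c,
         ((a, b) \in r) && ((b, c) \in r) ==> ((a, c) \in r)]].

(* The elements of [A] lying in [S] come first, then those outside [S], both
   groups keeping their order in [r]. *)
Definition move_to_front S A r : {set V * V} :=
  [set p in setX A A |
     if (p.1 \in S) == (p.2 \in S) then p \in r else p.1 \in S].

Lemma move_to_front_linear S A r :
  linear_order A r -> linear_order A (move_to_front S A r).
Proof.
case/and4P=> _ /'forall_in_'forall_in_orP tot /'forall_'forall_implyP asym.
move=> /'forall_'forall_'forall_implyP trans.
apply/and4P; split.
- by apply/subsetP=> p; rewrite inE => /andP[].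
- apply/'forall_in_'forall_in_orP=> a aA b bA; rewrite !inE /= aA bA /=.
  have [] := tot a aA b bA; move=> ->; case: (a \in S); case: (b \in S);
    by [left | right].
- apply/'forall_'forall_implyP=> a b; rewrite !inE /=.
  move: (asym a b); case: (a \in S); case: (b \in S);
    rewrite ?andbF //= => h /andP[/andP[_ h1] /andP[_ h2]];
    by apply: h; rewrite h1 h2.
- apply/'forall_'forall_'forall_implyP=> a b c; rewrite !inE /=.
  move: (trans a b c) => h.
  case/andP=> /andP[/andP[-> _]] + /andP[/andP[_ ->]].
  case: (a \in S); case: (b \in S); case: (c \in S) => //= h1 h2;
    by apply: h; rewrite h1 h2.
Qed.

Definition refines (P Q : {set {set V}}) : bool :=
  [forall B in Q, exists S : {set {set V}}, (S \subset P) && (B == cover S)].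

End LinearOrders.

Definition local_ordering (T : rooted_tree) : finType :=
  {p : {ffun inner T -> {set T * T}} |
     [forall x, linear_order (children (val x)) (p x)]}.

Definition act_family (T : rooted_tree) (E : {set T}) (p : local_ordering T) :
    {ffun inner T -> {set T * T}} :=
  [ffun x => move_to_front [set y | related E y] (children (val x)) (val p x)].

Lemma act_family_linear (T : rooted_tree) (E : {set T}) (p : local_ordering T) :
  [forall x, linear_order (children (val x)) (act_family E p x)].
Proof.
apply/forallP=> x; rewrite ffunE.
exact/move_to_front_linear/(forallP (valP p)).
Qed.

Definition act (T : rooted_tree) (E : {set T}) (p : local_ordering T) :
  local_ordering T := exist _ (act_family E p) (act_family_linear E p).

Definition local_partition (T : rooted_tree) : finType :=
  {a : {ffun inner T -> {set {set T}}} |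
     [forall x, partition (a x) (children (val x))]}.

Definition related_partition (T : rooted_tree) (E : {set T}) (x : T) :
    {set {set T}} :=
  [set [set y in children x | related E y];
       [set y in children x | ~~ related E y]] :\ set0.

Definition compatible (T : rooted_tree) (a : local_partition T) (E : {set T}) :
    bool :=
  [forall x : inner T, refines (val a x) (related_partition E (val x))].

Local Open Scope ring_scope.

Section Walk.
Variables (R : realType) (T : rooted_tree) (w : {set T} -> R).

(* Only the values of [w] on subsets of [leaves T] are ever used. *)
Definition probability_on_leaf_sets : Prop :=
  (forall E, E \in powerset (leaves T) -> 0 <= w E) /\
  \sum_(E in powerset (leaves T)) w E = 1.

Definition transition (p q : local_ordering T) : R :=
  \sum_(E in powerset (leaves T) | act E p == q) w E.

Definition transition_matrix : 'M[R]_#|local_ordering T| :=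
  \matrix_(i, j) transition (enum_val i) (enum_val j).

Definition walk_eigenvalue (a : local_partition T) : R :=
  \sum_(E in powerset (leaves T) | compatible a E) w E.

End Walk.

Definition walk_multiplicity (T : rooted_tree) (a : local_partition T) : nat :=
  (\prod_(x : inner T) \prod_(B in val a x) (#|B|.-1)`!)%N.

(* In a pure tree of depth [d] the leaves are exactly the nodes of depth [d],
   and the inner nodes are exactly those of smaller depth. *)
Section Depth.
Variable T : rooted_tree.
Implicit Types x y : T.

Lemma depth_root : depth (root T) = 0%N.
Proof.
by rewrite /depth; case: ex_minnP => m _ /(_ 0%N); rewrite eqxx leqn0 => /(_ isT)/eqP.
Qed.

Lemma depth_child x y : y \in children x -> depth y = (depth x).+1.
Proof.
rewrite inE => /andP[yr /eqP pyx]; rewrite /depth.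
case: ex_minnP => -[|m]; first by rewrite /= (negbTE yr).
rewrite iterSr pyx => hm minm; case: ex_minnP => n hn minn.
apply/eqP; rewrite eqSS eqn_leq (minn _ hm) andbT -ltnS.
by apply: minm; rewrite iterSr pyx.
Qed.

Lemma pure_depth d : pure_of_depth T d ->
  forall x, (depth x <= d)%N /\ (x \in leaves T) = (depth x == d).
Proof.
move=> pureT.
have leD x : exists2 y, y \in leaves T & (depth x <= depth y ?= iff (x \in leaves T))%N.
  have depth_bound : exists M, forall z : T, (depth z <= M)%N.
    by exists (\max_(z : T) depth z)%N => z; apply: leq_bigmax.
  have [M ltM] := depth_bound.
  have [n] : exists n, (M < n + depth x)%N by exists M.+1; rewrite addSn ltnS leq_addr.
  elim: n x => [|n IH] x lt_n.
    by have := ltM x; rewrite leqNgt lt_n.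
  case: (boolP (x \in leaves T)) => [xL | xNL].
    by exists x => //; split; rewrite ?leqnn ?eqxx.
  move: (xNL); rewrite inE => /set0Pn[y yx].
  have dy := depth_child yx.
  have [|z zL [lez _]] := IH y; first by rewrite dy addnS -addSn.
  exists z => //; have ltxz : (depth x < depth z)%N by rewrite -dy.
  by split; [exact: ltnW | rewrite ltn_eqF].
move=> x; have [y yL [lexy <-]] := leD x.
by rewrite -(pureT y yL).
Qed.

End Depth.

(* Main.v *)
(* Let A_s be the matrix of the composite action of a word s of leaf sets. It
   only depends on stable sorting by the memberships recorded in s: a further,
   innermost E changes nothing if its relatedness is constant on the classes of
   elements that s does not separate. Hence P A_s = lam_s A_s + (terms A_{Es}
   with E separating more), where lam_s is the weight of the sets that do not
   separate more, and lam strictly increases along terms of positive weight.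
   So the product of P - l over the distinct values l of lam annihilates P,
   which is therefore diagonalizable.
   The multiplicities are read off the traces of the powers of P. The trace of
   A_s counts the local orderings sorted by s, a product of factorials of class
   sizes; as |A|! is the sum of prod_B (|B|-1)! over the partitions of A, it is
   the sum of m_alpha over the alpha compatible with s. Expanding P^k into words
   gives tr P^k = sum_alpha m_alpha eps_alpha^k. *)
Require Import Defs.
From HB Require Import structures.
From mathcomp Require Import all_boot all_order all_algebra.
From mathcomp Require Import reals zify.

Set Implicit Arguments.
Unset Strict Implicit.
Unset Printing Implicit Defensive.

Import Order.TTheory GRing.Theory Num.Theory.
Local Open Scope ring_scope.

(** * Walks generated by a left regular band *)

Lemma char_poly_conj (F : fieldType) n (P A : 'M[F]_n) :
  P \in unitmx -> char_poly (P *m A *m invmx P) = char_poly A.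
Proof.
move=> Pu; rewrite /char_poly /char_poly_mx.
have -> : 'X%:M - map_mx polyC (P *m A *m invmx P) =
    map_mx polyC P *m ('X%:M - map_mx polyC A) *m map_mx polyC (invmx P).
  rewrite mulmxBr mulmxBl scalar_mxC -[_ *m _ *m map_mx _ (invmx P)]mulmxA.
  by rewrite -!map_mxM mulmxV // map_mx1 mulmx1.
by rewrite !det_mulmx mulrAC -det_mulmx -map_mxM mulmxV // map_mx1 det1 mul1r.
Qed.

(** Power sums determine a finite family with multiplicities. The trace identity extends by
    linearity from monomials to all polynomials, a suitable polynomial isolates [l], and
    characteristic zero brings the equality back to [nat]. *)
Lemma mup_char_poly_trace (F : numFieldType) n (A : 'M[F]_n.+1) (J : finType)
    (e : J -> F) (m : J -> nat) :
    diagonalizable A ->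
    (forall k, \tr (A ^+ k) = \sum_j (e j ^+ k) *+ m j) ->
  forall l, mup l (char_poly A) = (\sum_(j | e j == l) m j)%N.
Proof.
case=> P Pu /(diagonalizable_forPex)[d /(simmxRL Pu) defd] trA l.
have trD (p : {poly F}) : \sum_i p.[d 0 i] = \sum_j p.[e j] *+ m j.
  have trX k : \sum_i d 0 i ^+ k = \sum_j (e j ^+ k) *+ m j.
    rewrite -trA.
    suff -> : A ^+ k = invmx P *m (diag_mx d) ^+ k *m P.
      rewrite mxtrace_mulC mulmxA mulmxV // mul1mx.
      suff -> : diag_mx d ^+ k = diag_mx (\row_i (d 0 i ^+ k)).
        by rewrite mxtrace_diag; apply: eq_bigr => i _; rewrite mxE.
      elim: k => [|k IH]; first by apply/matrixP=> i j; rewrite !mxE.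
      rewrite exprS IH -[_ * _]/(_ *m _) mulmx_diag; congr diag_mx.
      by apply/rowP=> i; rewrite !mxE exprS.
    elim: k => [|k IH]; first by rewrite !expr0 mulmx1 mulVmx.
    have PD : invmx P *m diag_mx d = A *m invmx P.
      by rewrite defd !mulmxA mulVmx // mul1mx.
    by rewrite !exprS IH -!mulmxE !mulmxA PD.
  under eq_bigr do rewrite horner_coef.
  under [RHS]eq_bigr do rewrite horner_coef -sumrMnl.
  rewrite exchange_big [RHS]exchange_big; apply: eq_bigr => k _ /=.
  rewrite -mulr_sumr trX mulr_sumr; apply: eq_bigr => j _.
  by rewrite mulrnAr.
have -> : char_poly A = \prod_(x <- [seq d 0 i | i <- enum 'I_n.+1]) ('X - x%:P).
  rewrite -(char_poly_conj A Pu) -defd char_poly_trig ?diag_mx_is_trig //.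
  by rewrite big_image; apply: eq_bigr => i _; rewrite mxE eqxx mulr1n.
rewrite mu_prod_XsubC count_map -sum1_count big_enum_cond /=.
(* [p] vanishes at every diagonal entry and every [e j] other than [l], but not at [l], so [trD p]
   keeps only [p.[l]] times each of the two multiplicities. *)
pose rs := [seq x <- [seq d 0 i | i <- enum 'I_n.+1] ++ [seq e j | j <- enum J]
           | x != l].
pose p := \prod_(x <- rs) ('X - x%:P).
have pE x : x \in rs -> p.[x] = 0.
  by move=> xrs; apply/eqP; rewrite -/(root p x) root_prod_XsubC.
have pl : p.[l] != 0.
  by rewrite -/(root p l) root_prod_XsubC mem_filter eqxx.
have := trD p.
rewrite (bigID (fun i => d 0 i == l)) /= [X in _ + X]big1 ?addr0; last first.
  move=> i di; apply: pE; rewrite mem_filter di mem_cat map_f ?mem_enum //.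
rewrite [RHS](bigID (fun j => e j == l)) /= [X in _ = _ + X]big1 ?addr0; last first.
  move=> j ej; rewrite pE ?mul0rn // mem_filter ej mem_cat orbC map_f ?mem_enum //.
rewrite (eq_bigr (fun=> p.[l])); last by move=> i /eqP->.
rewrite [RHS](eq_bigr (fun j => p.[l] *+ m j)); last by move=> i /eqP->.
rewrite sumrMnr sumr_const -(mulr_natr _ #|_|) -[RHS]mulr_natr.
move/(mulfI pl)/eqP; rewrite eqr_nat -sum1_card => /eqP <-.
by apply: eq_bigl => i; rewrite eq_sym.
Qed.

(* [A s] stands for the product [s] of generators in a left regular band acting
   on a space, [P] for the weighted sum of the generators, and [cpt s i] says
   that the support of the generator [i] lies below that of [s]. *)
Section LeftRegularBandWalk.
Variables (F : realFieldType) (n : nat) (I : finType) (w : I -> F).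
Variables (P : 'M[F]_n.+1) (A : seq I -> 'M[F]_n.+1).
Hypothesis w_ge0 : forall i, 0 <= w i.
Hypothesis A_nil : A [::] = 1.
Hypothesis A_step : forall s, P * A s = \sum_i w i *: A (i :: s).

(** The induction runs over all words at once: a factor [P] absorbed by [A_step] prepends some [i]
    to [s], which keeps only the [j] with [c j i], and summing [w i] over these [i] contributes one
    factor [e j]. *)
Lemma trace_exp_walk (J : finType) (c : J -> pred I) (m : J -> nat) :
    (forall s, \tr (A s) = (\sum_(j | all (c j) s) m j)%:R) ->
  forall k, \tr (P ^+ k) = \sum_j ((\sum_(i | c j i) w i) ^+ k) *+ m j.
Proof.
move=> trA k; set e := fun j => \sum_(i | c j i) w i.
suff IHs s : \tr (P ^+ k * A s) = \sum_(j | all (c j) s) (e j ^+ k) *+ m j.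
  by have := IHs [::]; rewrite A_nil mulr1.
elim: k s => [|k IH] s.
  by rewrite mul1r trA natr_sum.
rewrite exprSr -mulrA A_step mulr_sumr raddf_sum /=.
under eq_bigr do rewrite -scalerAr mxtraceZ IH mulr_sumr big_mkcond /=.
rewrite exchange_big [RHS]big_mkcond /=; apply: eq_bigr => j _.
case: (all (c j) s); last by apply: big1 => i _; rewrite andbF.
rewrite exprS mulr_suml -sumrMnl [RHS]big_mkcond; apply: eq_bigr => i _.
by rewrite andbT; case: ifP => // _; rewrite mulrnAr.
Qed.

Variable cpt : seq I -> pred I.
Hypothesis A_cpt : forall s i, cpt s i -> A (i :: s) = A s.
Hypothesis cpt_cons : forall s i j, cpt s j -> cpt (i :: s) j.
Hypothesis cpt_head : forall s i, cpt (i :: s) i.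

Let lam s := \sum_(i | cpt s i) w i.

(* Multiplying [A s] by [P - lam s] leaves only words [i :: s] of strictly
   larger support, and for these [lam] is strictly larger because [w i > 0]. *)
Lemma walk_annihilated (rs : seq F) s :
    uniq rs -> (forall s, lam s \in rs) ->
  horner_mx P (\prod_(x <- rs | lam s <= x) ('X - x%:P)) * A s = 0.
Proof.
move=> urs lamrs.
have [k] := ubnP #|[pred i | ~~ cpt s i]|; elim: k s => // k IH s lt_k.
(* The factor at [lam s] occurs since [lam s] is in [rs]; it is applied to [A s] first, where the
   terms with [cpt s i] sum to [lam s *: A s] and cancel. *)
rewrite big_mkcond (bigD1_seq (lam s)) //= lexx -big_mkcondr /= mulrC.
set p := \prod_(_ <- _ | _) _.
rewrite rmorphM -mulrA rmorphB /= horner_mx_X horner_mx_C mulrBl A_step.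
rewrite [_%:M * _]mul_scalar_mx scaler_suml (bigID (cpt s)) /=.
rewrite (eq_bigr (fun i => w i *: A s)); last by move=> i /A_cpt->.
rewrite addrAC subrr add0r mulr_sumr big1 // => i ncpt.
have [-> | wi] := eqVneq (w i) 0; first by rewrite scale0r mulr0.
have lt_lam : lam s < lam (i :: s).
  have wi_gt0 : 0 < w i by rewrite lt_def wi w_ge0.
  rewrite /lam [ltRHS](bigID (cpt s)) /=.
  rewrite (eq_bigl (cpt s)); last first.
    by move=> j; rewrite andbC; case: (boolP (cpt s j)) => // /cpt_cons->.
  rewrite ltrDl (bigD1 i) /=; last by rewrite cpt_head.
  by rewrite ltr_wpDr // sumr_ge0.
(* Every [x] with [lam (i :: s) <= x] differs from [lam s], so all factors required by the induction
   hypothesis are still present in [p]. *)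
have -> : p =
    (\prod_(x <- rs | (x != lam s) && (lam s <= x) && ~~ (lam (i :: s) <= x))
       ('X - x%:P)) * \prod_(x <- rs | lam (i :: s) <= x) ('X - x%:P).
  rewrite /p (bigID (fun x => lam (i :: s) <= x)) /= mulrC; congr (_ * _).
  apply: eq_bigl => x; apply: andb_idl => /(lt_le_trans lt_lam) lt_x.
  by rewrite gt_eqF ?ltW.
rewrite rmorphM /= -mulrA -scalerAr IH ?scaler0 ?mulr0 //.
rewrite ltnS in lt_k; apply: leq_trans lt_k; apply: proper_card.
apply/properP; split; last by exists i; rewrite !inE ?cpt_head.
by apply/subsetP=> j; rewrite !inE; apply/contra/cpt_cons.
Qed.

(** The distinct values of [e] contain those of [lam], and since [A [::] = 1] the product of the
    linear factors at these values kills [P]. The factors at values below [lam [::]] merely multiply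
    zero. *)
Lemma diagonalizable_walk (J : finType) (e : J -> F) :
  (forall s, exists j, lam s = e j) -> diagonalizable P.
Proof.
move=> lam_e; apply/diagonalizableP; exists (undup (codom e)); first exact: undup_uniq.
rewrite mxminpoly_min //.
rewrite (bigID (fun x => lam [::] <= x)) /= mulrC rmorphM /= -[X in _ * X]mulr1 -A_nil.
rewrite walk_annihilated ?undup_uniq ?mulr0 // => s.
by have [j ->] := lam_e s; rewrite mem_undup codom_f.
Qed.

End LeftRegularBandWalk.

(** The size is assumed positive because it will be [#|local_ordering T|]; the case split restores
    the form [n.+1] that makes matrices a ring. The last hypothesis puts each weight
    [\sum_(i | cpt s i) w i] among the values indexed by [J]. *)
Lemma walk_spectrum (F : realFieldType) n (I J : finType) (w : I -> F)
    (P : 'M[F]_n) (A : seq I -> 'M[F]_n) (cpt : seq I -> pred I)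
    (c : J -> pred I) (m : J -> nat) :
    (0 < n)%N -> (forall i, 0 <= w i) -> A [::] = 1%:M ->
    (forall s, P *m A s = \sum_i w i *: A (i :: s)) ->
    (forall s, \tr (A s) = (\sum_(j | all (c j) s) m j)%:R) ->
    (forall s i, cpt s i -> A (i :: s) = A s) ->
    (forall s i j, cpt s j -> cpt (i :: s) j) ->
    (forall s i, cpt (i :: s) i) ->
    (forall s, exists j, cpt s =1 c j) ->
  diagonalizable P /\
  forall l, mup l (char_poly P) = (\sum_(j | (\sum_(i | c j i) w i)%R == l) m j)%N.
Proof.
case: n P A => // n P A _ w_ge0 A_nil A_step trA A_cpt cpt_cons cpt_head cpt_c.
have diagP : diagonalizable P.
  apply: (diagonalizable_walk w_ge0 A_nil A_step A_cpt cpt_cons cpt_head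
    (e := fun j => \sum_(i | c j i) w i)) => s.
  by have [j cj] := cpt_c s; exists j; apply: eq_bigl.
split=> // l; apply: mup_char_poly_trace => // k.
exact: (trace_exp_walk A_nil A_step trA).
Qed.

(** * Linear orders and partitions sorted by a key *)

Section KeySortedOrders.
Variable V : finType.
Implicit Types (A B K U : {set V}) (r : {set V * V}) (s : seq {set V}).

(* The last set of [s] is the most significant, because [moves_to_front] applies
   the sets of [s] from the head on and the last move dominates. *)
Fixpoint lex_key s (a : V) : nat :=
  if s is U :: s' then ((lex_key s' a).*2 + (a \notin U))%N else 0%N.

Definition moves_to_front A s r : {set V * V} :=
  foldl (fun r U => move_to_front U A r) r s.

(** The binary digits of the key record non-membership in the sets of [s], the head giving the
    lowest digit; parity and halving recover them one by one. *)
Lemma lex_key_eqP s a b :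
  reflect (forall U, U \in s -> (a \in U) = (b \in U)) (lex_key s a == lex_key s b).
Proof.
elim: s => [|U s IH] /=; first exact: ReflectT.
apply: (iffP eqP) => [eqk | eqS].
  have eqaS : (a \in U) = (b \in U).
    by have := congr1 odd eqk; rewrite !oddD !odd_double /= !oddb => /negb_inj.
  move=> W; rewrite inE => /predU1P[-> // | Us]; apply: IH Us.
  by move/eqP: eqk; rewrite eqaS eqn_add2r -!muln2 eqn_pmul2r.
rewrite eqS ?mem_head //; congr (_.*2 + _)%N; apply/eqP/IH => W Us.
by rewrite eqS // inE Us orbT.
Qed.

Lemma lex_key_lt s a : (lex_key s a < 2 ^ size s)%N.
Proof.
elim: s => //= U s IH; rewrite expnS mul2n -!addnn.
by case: (a \notin U) => /=; lia.
Qed.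

(** This is radix sort: each stable move sorts by one binary digit of the key, lowest digit first,
    so [r] only breaks ties. *)
Lemma in_moves_to_front A s r a b : r \subset setX A A ->
  ((a, b) \in moves_to_front A s r) =
  [&& a \in A, b \in A &
    (lex_key s a < lex_key s b)%N || (lex_key s a == lex_key s b) && ((a, b) \in r)].
Proof.
rewrite /moves_to_front; elim: s r => [|U s IH] r rA /=.
  apply/idP/and3P => [abr | [_ _ ] //]; split=> //;
  by have /(subsetP rA) := abr; rewrite inE => /andP[].
rewrite IH; last by apply/subsetP=> p; rewrite inE => /andP[].
rewrite !inE /=; case: (a \in A) => //=; case: (b \in A) => //=.
case: ((a, b) \in r); case: (a \in U); case: (b \in U) => /=;
  rewrite ?andbF ?andbT; lia.
Qed.

(** * Counting sorted linear orders and partitions into blocks of constant key *)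

Variable key : V -> nat.

Definition key_sorted r := [forall a, forall b, ((a, b) \in r) ==> (key a <= key b)%N].

Definition sorted_orders A : {set {set V * V}} :=
  [set r | linear_order A r && key_sorted r].

Definition key_constant (P : {set {set V}}) :=
  [forall B in P, forall a in B, forall b in B, key a == key b].

Lemma linear_orderP A r :
  reflect [/\ forall a b, (a, b) \in r -> a \in A /\ b \in A,
      forall a b, a \in A -> b \in A -> (a, b) \in r \/ (b, a) \in r,
      forall a b, (a, b) \in r -> (b, a) \in r -> a = b &
      forall a b c, (a, b) \in r -> (b, c) \in r -> (a, c) \in r]
    (linear_order A r).
Proof.
apply: (iffP and4P) => [[/subsetP rA tot asym trans] | [rA tot asym trans]].
  split.
  - by move=> a b /rA; rewrite inE => /andP[].
  - by move=> a b aA bA; move/'forall_in_'forall_in_orP: tot; apply.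
  - move=> a b ab ba; move/'forall_'forall_implyP: asym => /(_ a b).
    by rewrite ab ba => /(_ isT)/eqP.
  - move=> a b c ab bc; move/'forall_'forall_'forall_implyP: trans => /(_ a b c).
    by rewrite ab bc; apply.
split.
- by apply/subsetP=> -[a b] /rA[aA bA]; rewrite inE /= aA.
- by apply/'forall_in_'forall_in_orP=> a aA b; apply: tot.
- by apply/'forall_'forall_implyP=> a b /andP[ab ba]; apply/eqP/asym.
- by apply/'forall_'forall_'forall_implyP=> a b c /andP[]; apply: trans.
Qed.

Lemma linear_order_subset A r : linear_order A r -> r \subset setX A A.
Proof. by case/and4P. Qed.

Lemma linear_order_min A r : linear_order A r -> A != set0 ->
  exists2 a, a \in A & forall b, b \in A -> (a, b) \in r.
Proof.
move=> /linear_orderP[rA tot asym trans] /set0Pn[a0 a0A].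
(* The minimum is the element with the largest up-set: if [a] were not below [b], the up-set of [b]
   would contain that of [a] and also [b] itself. *)
case: (arg_maxnP (fun a => #|[set b | (a, b) \in r]|) a0A) => a aA maxa.
exists a => // b bA; apply: contraT => nab.
have ba : (b, a) \in r by case: (tot _ _ aA bA) nab => // ->.
have := maxa b bA; rewrite /= leqNgt => /negP[]; apply: proper_card.
apply/properP; split; first by apply/subsetP=> c; rewrite !inE; apply: trans.
by exists b; rewrite !inE //; case: (tot b b bA bA).
Qed.

Lemma key_sortedP r :
  reflect (forall a b, (a, b) \in r -> (key a <= key b)%N) (key_sorted r).
Proof. exact: 'forall_'forall_implyP. Qed.

Lemma sorted_ordersP A r :
  reflect (linear_order A r /\ forall a b, (a, b) \in r -> (key a <= key b)%N)
    (r \in sorted_orders A).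
Proof. by rewrite inE; apply: (iffP andP) => -[rA /key_sortedP]. Qed.

Variable N : nat.
Hypothesis keyN : forall a, (key a < N)%N.

Definition class_factorials A := (\prod_(k < N) #|[set a in A | key a == k]|`!)%N.

Definition key_class A a := [set b in A | key b == key a].

(** As [B] lies in one key class, only the factor of that class changes. This serves for [B] empty
    (to isolate the factor), a singleton (a removed minimum) and a block of a partition. *)
Lemma class_factorialsD A a B : a \in A -> B \subset key_class A a ->
  class_factorials (A :\: B) = ((#|key_class A a| - #|B|)`! *
    \prod_(k < N | k != Ordinal (keyN a)) #|[set b in A | key b == k]|`!)%N.
Proof.
move=> aA BK; rewrite /class_factorials (bigD1 (Ordinal (keyN a))) //=.
congr (_ * _)%N.
  have -> : (#|key_class A a| - #|B| = #|key_class A a :\: B|)%N.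
    by rewrite cardsD (setIidPr BK).
  by congr factorial; apply: eq_card => b; rewrite !inE andbA.
apply: eq_bigr => k nk; congr factorial; apply: eq_card => b; rewrite !inE.
case: (boolP (b \in B)) => //= /(subsetP BK); rewrite inE => /andP[bA /eqP->].
by rewrite bA; apply/esym/negbTE; apply: contra nk => /eqP nk; apply/eqP/val_inj.
Qed.

(** Deleting the first element [a] ([f]) and putting it back in front ([g]) are mutually inverse;
    [g] yields a sorted order because [a] has least key. *)
Lemma card_sorted_orders_min A a :
    a \in A -> (forall b, b \in A -> (key a <= key b)%N) ->
  #|[set r in sorted_orders A | [forall b in A, (a, b) \in r]]| =
  #|sorted_orders (A :\ a)|.
Proof.
move=> aA mina.
pose f r := r :&: setX (A :\ a) (A :\ a).
pose g r := r :|: setX [set a] A.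
rewrite -(@card_in_imset _ _ f); last first.
  apply: (@can_in_inj _ _ _ _ g) => r.
  rewrite !inE => /andP[/andP[rA _] /forall_inP rmin].
  have [r1 tot asym trans] := linear_orderP _ _ rA.
  apply/setP=> -[b c]; rewrite !inE /=.
  have [-> /= | nba] := eqVneq b a.
    by rewrite andbF /=; apply/idP/idP => [/rmin | /r1[]].
  rewrite orbF /=; have [-> /= | nca] := eqVneq c a; last first.
    by apply/andP/idP => [[] | bcr] //; have [-> ->] := r1 _ _ bcr.
  rewrite !andbF; apply/esym/negbTE; apply: contra nba => bar.
  by rewrite (asym _ _ bar) // rmin //; case: (r1 _ _ bar).
apply: eq_card => r; apply/imsetP/idP => [[r0 + ->] | ].
  rewrite !inE => /andP[/andP[rA /key_sortedP srt] /forall_inP rmin].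
  have [r1 tot asym trans] := linear_orderP _ _ rA.
  apply/andP; split; last first.
    by apply/key_sortedP=> b c; rewrite inE => /andP[/srt].
  apply/linear_orderP; split.
  - by move=> b c; rewrite !inE /= => /and3P[_ -> ->].
  - by move=> b c bA cA; rewrite !in_setI !in_setX bA cA !andbT; move: bA cA;
      rewrite !inE => /andP[_ bA] /andP[_ cA]; apply: tot.
  - by move=> b c /setIP[bc _] /setIP[cb _]; apply: asym.
  - move=> b c d /setIP[bc]; rewrite in_setX => /andP[bA _].
    move=> /setIP[cd]; rewrite in_setX => /andP[_ dA].
    by rewrite in_setI in_setX bA dA (trans _ _ _ bc cd).
rewrite inE => /andP[rA /key_sortedP srt].
have [r1 tot asym trans] := linear_orderP _ _ rA.
have r2 b c : (b, c) \in r -> [/\ b \in A, c \in A, b != a & c != a].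
  by move=> /r1[]; rewrite !inE => /andP[-> ->] /andP[-> ->].
have inG b c : ((b, c) \in g r) = ((b, c) \in r) || (b == a) && (c \in A).
  by rewrite !inE.
exists (g r); last first.
  apply/setP=> -[b c]; rewrite in_setI inG in_setX.
  apply/idP/andP => [bcr | [/orP[//|/andP[/eqP-> _]]]]; last by rewrite !inE eqxx.
  by rewrite bcr; have [-> ->] := r1 _ _ bcr.
rewrite !inE; apply/andP; split; last first.
  by apply/forall_inP=> b bA; rewrite inG eqxx bA orbT.
apply/andP; split; last first.
  apply/key_sortedP=> b c; rewrite inG => /orP[/srt // | /andP[/eqP-> cA]].
  exact: mina.
apply/linear_orderP; split.
- by move=> b c; rewrite inG => /orP[/r2[] // | /andP[/eqP->]].
- move=> b c bA cA; rewrite !inG bA cA !andbT.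
  have [_|nba] := eqVneq b a; first by rewrite orbT; left.
  have [_|nca] := eqVneq c a; first by rewrite orbT; right.
  by rewrite !orbF; apply: tot; rewrite !inE ?nba ?nca.
- move=> b c; rewrite !inG => /orP[bc | /andP[/eqP-> cA]].
    case/orP; first exact: asym.
    by case/andP => /eqP eqc _; have [_ _ _] := r2 _ _ bc; rewrite eqc eqxx.
  by case/orP => [/r2[_ _ _] | /andP[/eqP->] //]; rewrite eqxx.
- move=> b c d; rewrite !inG => /orP[bc | /andP[/eqP-> cA]].
    case/orP => [cd | ]; first by rewrite (trans _ _ _ bc cd).
    by case/andP => /eqP eqc _; have [_ _ _] := r2 _ _ bc; rewrite eqc eqxx.
  by case/orP => [/r2[_ dA _ _] | /andP[_ dA]]; rewrite eqxx dA orbT.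
Qed.

Lemma card_sorted_orders A : #|sorted_orders A| = class_factorials A.
Proof.
have [k] := ubnP #|A|; elim: k A => // k IH A ltk.
have [-> | nA] := eqVneq A set0.
  rewrite /class_factorials big1 => [|i _]; last first.
    by rewrite (_ : [set _ in _ | _] = set0) ?cards0 //; apply/setP=> b; rewrite !inE.
  apply/eqP/cards1P; exists set0; apply/setP=> r; rewrite !inE.
  apply/andP/eqP => [[/linear_order_subset + _] | ->].
    rewrite (_ : setX _ _ = set0) ?subset0 => [/eqP//|].
    by apply/setP=> b; rewrite !inE.
  split; last by apply/key_sortedP=> a b; rewrite inE.
  by apply/linear_orderP; split=> a b; rewrite ?inE //; move=> c; rewrite inE.
have [a0 a0A] := set0Pn _ nA.
case: (arg_minnP key a0A) => a aA mina {a0 a0A}.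
transitivity (\sum_(b in key_class A a) #|sorted_orders (A :\ b)|)%N.
  transitivity (\sum_(b in key_class A a)
      \sum_(r in sorted_orders A | [forall c in A, (b, c) \in r]) 1)%N; last first.
    apply: eq_bigr => b; rewrite inE => /andP[bA /eqP kb].
    rewrite -(@card_sorted_orders_min A b) // => [|c /mina]; last by rewrite kb.
    by rewrite -sum1_card; apply: eq_bigl => r; rewrite !inE.
  rewrite (exchange_big_dep (mem (sorted_orders A))) /=; last by move=> b r _ /andP[].
  rewrite -sum1_card; apply: eq_bigr => r rS.
  move: (rS); rewrite inE => /andP[rA /key_sortedP srt].
  have [b bA minb] := linear_order_min rA nA.
  have [r1 tot asym trans] := linear_orderP _ _ rA.
  rewrite (big_pred1 b) // => c; rewrite inE rA (introT (key_sortedP r) srt) /=.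
  apply/andP/eqP => [[/andP[cA _] /forall_inP minc] | ->].
    by apply: asym; [apply: minc | apply: minb].
  rewrite bA eqn_leq mina // srt ?minb //; split=> //.
  exact/forall_inP.
have aK : a \in key_class A a by rewrite inE eqxx andbT; exact: aA.
have sub0 : set0 \subset key_class A a by rewrite sub0set.
have := class_factorialsD aA sub0; rewrite setD0 cards0 subn0 => ->.
set rest := (\prod_(_ < _ | _) _)%N.
rewrite (eq_bigr (fun=> (#|key_class A a|.-1)`! * rest)%N).
  by rewrite sum_nat_const mulnA (cardsD1 a) aK /= -factS.
move=> b bK; rewrite IH; last first.
  by move: bK; rewrite inE => /andP[bA _]; rewrite (cardsD1 b A) bA in ltk.
by rewrite (class_factorialsD aA) ?sub1set // cards1 subn1.
Qed.

Lemma sum_block_factorials K a : a \in K ->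
  (\sum_(B : {set V} | (a \in B) && (B \subset K))
     (#|B|.-1)`! * (#|K| - #|B|)`! = #|K|`!)%N.
Proof.
move=> aK; rewrite (reindex_onto (fun C => a |: C) (fun B => B :\ a)) /=; last first.
  by move=> B /andP[aB _]; rewrite setD1K.
set n := #|K :\ a|; have cardK : #|K| = n.+1 by rewrite (cardsD1 a) aK.
transitivity (\sum_(C : {set V} | C \subset K :\ a) #|C|`! * (n - #|C|)`!)%N.
  apply: eq_big => [C | C].
    rewrite subUset sub1set aK setU11 /= subsetD1; congr (_ && _).
    by apply/eqP/idP => [<- | aC]; [rewrite !inE eqxx | rewrite setU1K].
  rewrite subUset setU11 /= => /andP[_ /eqP CaC].
  have aC : a \notin C by rewrite -CaC !inE eqxx.
  by rewrite cardsU1 aC cardK /= subSS.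
(* A subset of [K :\ a] has at most [n] elements, so [inord] returns its true size. *)
rewrite (partition_big (fun C : {set V} => inord #|C| : 'I_n.+1) predT) //=.
rewrite (eq_bigr (fun=> n`!)) => [|k _].
  by rewrite sum_nat_const card_ord cardK.
rewrite (eq_big (fun C => C \in [set B : {set V} | (B \subset K :\ a) & #|B| == k])
   (fun=> k`! * (n - k)`!)%N) => [||C].
- by rewrite sum_nat_const cards_draws bin_fact // -ltnS.
- move=> C; rewrite inE; case: (boolP (C \subset _)) => //= /subset_leq_card leC.
  by rewrite -val_eqE /= inordK.
- by case/andP=> /subset_leq_card leC /eqP <-; rewrite inordK.
Qed.

(** Both sides count the permutations that preserve every key class, the left one by their partition
    into cycles. The induction removes the block [B] of a chosen [a], and [sum_block_factorials]
    sums over [B]. *)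
Lemma sum_key_constant_partitions A :
  (\sum_(P : {set {set V}} | partition P A && key_constant P)
     \prod_(B in P) (#|B|.-1)`! = class_factorials A)%N.
Proof.
have [k] := ubnP #|A|; elim: k A => // k IH A ltk.
have [-> | nA] := eqVneq A set0.
  rewrite /class_factorials [RHS]big1 => [|i _]; last first.
    by rewrite (_ : [set _ in _ | _] = set0) ?cards0 //; apply/setP=> b; rewrite !inE.
  rewrite (big_pred1 set0) ?big_set0 // => P; rewrite partition_set0.
  by apply: andb_idr => /eqP->; apply/forall_inP=> B; rewrite inE.
have [a aA] := set0Pn _ nA.
have aK : a \in key_class A a by rewrite inE aA eqxx.
rewrite (partition_big (fun P => pblock P a)
          (fun B : {set V} => (a \in B) && (B \subset key_class A a))) /=; last first.
  move=> P /andP[PA /'forall_in_'forall_in_'forall_in_eqP constP].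
  have aP : a \in cover P by rewrite (cover_partition PA).
  have BP := pblock_mem aP; rewrite mem_pblock aP; apply/subsetP=> b bB.
  rewrite inE (constP _ BP b bB a) ?mem_pblock // eqxx andbT.
  by apply: (subsetP (partitionS PA BP)).
have sub0 : set0 \subset key_class A a by rewrite sub0set.
have := class_factorialsD aA sub0; rewrite setD0 cards0 subn0 => ->.
set rest := (\prod_(_ < _ | _) _)%N.
rewrite -(sum_block_factorials aK) big_distrl /=.
apply: eq_bigr => B /andP[aB BK].
have BA : B \subset A.
  by apply: subset_trans BK _; apply/subsetP=> b; rewrite inE => /andP[].
have Bn0 : B != set0 by apply/set0Pn; exists a.
rewrite -mulnA -(class_factorialsD aA BK) -IH; last first.
  rewrite ltnS in ltk; apply: leq_trans ltk; apply: proper_card.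
  apply/properP; split; first exact: subsetDl.
  by exists a => //; rewrite inE aB.
(* Partitions of [A] in which [B] is the block of [a] correspond to partitions of [A :\: B]; key
   constancy carries over because [B] lies in one class. *)
rewrite (reindex_onto (fun P => B |: P) (fun P => P :\ B)) /=; last first.
  move=> P /andP[/andP[PA _] /eqP<-]; rewrite setD1K // pblock_mem //.
  by rewrite (cover_partition PA).
rewrite big_distrr /=.
have BnP P : partition P (A :\: B) -> B \notin P.
  move=> PA; apply/negP=> /(partitionS PA) /subsetP/(_ a aB).
  by rewrite inE aB.
apply: eq_big => [P | P].
  apply/idP/idP.
    case/andP=> /andP[/andP[PA cP] pB] /eqP BP.
    rewrite -{1}BP partitionD1 ?setU11 //=.
    apply/forall_inP=> C CP; move/forall_inP: cP; apply.
    by rewrite inE CP orbT.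
  case/andP=> PA cP; have BP := BnP P PA.
  have PA' : partition (B |: P) A.
    rewrite -(setID A B) (setIidPr BA); apply: partitionU1 => //.
    by rewrite -setI_eq0 setDE setICA setICr setI0.
  rewrite PA' setU1K // eqxx andbT /=; apply/andP; split.
    apply/forall_inP=> C /setU1P[-> | ]; last exact: (forall_inP cP).
    apply/'forall_in_'forall_in_eqP=> b bB c cB.
    have := subsetP BK b bB; rewrite inE => /andP[_ /eqP->].
    by have := subsetP BK c cB; rewrite inE => /andP[_ /eqP->].
  by apply/eqP/def_pblock; rewrite ?setU11 //; case/and3P: PA'.
case/andP=> _ /eqP BP; rewrite big_setU1 //.
by rewrite -BP !inE eqxx.
Qed.

Lemma card_sorted_orders_partitions A :
  #|sorted_orders A| = (\sum_(P : {set {set V}} | partition P A && key_constant P)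
     \prod_(B in P) (#|B|.-1)`!)%N.
Proof. by rewrite card_sorted_orders sum_key_constant_partitions. Qed.

End KeySortedOrders.

Lemma moves_to_front_fixed (V : finType) (A : {set V}) s r : linear_order A r ->
  (moves_to_front A s r == r) = (r \in sorted_orders (lex_key s) A).
Proof.
move=> rA; have rsub := linear_order_subset rA.
have [r1 tot asym trans] := linear_orderP _ _ rA.
apply/eqP/sorted_ordersP => [fix_r | [_ srt]].
  split=> // a b; rewrite -{1}fix_r in_moves_to_front //.
  by case/and3P=> _ _ /orP[/ltnW | /andP[/eqP-> _]].
apply/setP=> -[a b]; rewrite in_moves_to_front //; apply/and3P/idP => [[aA bA] | abr].
  case/orP => [lt_ab | /andP[] //]; case: (tot _ _ aA bA) => // /srt.
  by rewrite leqNgt lt_ab.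
have [-> ->] := r1 _ _ abr; split=> //.
by rewrite abr andbT orbC -leq_eqVlt srt.
Qed.

(** A half that is a union of blocks contains the whole block of each of its points. Conversely, if
    no block meets both halves, each half is the union of the blocks it contains. *)
Lemma refines_split (V : finType) (A U : {set V}) P : partition P A ->
  reflect (forall B, B \in P -> {in B &, forall a b, (a \in U) = (b \in U)})
    (refines P ([set [set y in A | y \in U]; [set y in A | y \notin U]] :\ set0)).
Proof.
move=> PA; have [/eqP covP trivP _] := and3P PA.
set Q := _ :\ set0.
have QP D : D \in Q -> exists v, D = [set y in A | (y \in U) == v].
  case/setD1P=> _ /set2P[]->; [exists true | exists false];
    by apply/setP=> y; rewrite !inE; case: (y \in U).
have Q_in a : a \in A -> [set y in A | (y \in U) == (a \in U)] \in Q.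
  move=> aA; apply/setD1P; split; first by apply/set0Pn; exists a; rewrite inE aA eqxx.
  by apply/set2P; case: (a \in U); [left | right]; apply/setP=> y; rewrite !inE;
    case: (y \in U).
apply: (iffP forall_inP) => [refP B BP a b aB bB | constP D /QP[v ->]].
  have aA := subsetP (partitionS PA BP) a aB.
  have /existsP[W /andP[WP /eqP covW]] := refP _ (Q_in a aA).
  have : a \in cover W by rewrite -covW inE aA eqxx.
  case/bigcupP=> C CW aC.
  have eqBC : B = C.
    by rewrite -(def_pblock trivP BP aB) (def_pblock trivP (subsetP WP C CW) aC).
  have : b \in cover W by apply/bigcupP; exists C; rewrite // -eqBC.
  by rewrite -covW inE => /andP[_ /eqP].
apply/existsP; exists [set B in P | B \subset [set y in A | (y \in U) == v]].
apply/andP; split; first by apply/subsetP=> B; rewrite inE => /andP[].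
rewrite eqEsubset; apply/andP; split; last first.
  by apply/bigcupsP=> B; rewrite inE => /andP[].
apply/subsetP=> y; rewrite inE => /andP[yA /eqP yv].
have yP : y \in cover P by rewrite covP.
apply/bigcupP; exists (pblock P y); last by rewrite mem_pblock.
rewrite inE pblock_mem //; apply/subsetP=> z zB.
rewrite inE (subsetP (partitionS PA (pblock_mem yP))) //=.
by rewrite (constP _ (pblock_mem yP) z y) ?yv ?mem_pblock.
Qed.

(** * Local orderings of a tree *)

Section TreeWalk.
Variable T : rooted_tree.
Implicit Types (E : {set T}) (s : seq {set T}) (x : inner T)
  (p : local_ordering T) (a : local_partition T).

Definition acts s p := foldl (fun q E => act E q) p s.

Definition related_sets s := [seq [set y | related E y] | E <- s].

Lemma acts_val s p x : val (acts s p) x =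
  moves_to_front (children (val x)) (related_sets s) (val p x).
Proof.
rewrite /acts /moves_to_front; elim: s p => //= E s IH p.
by rewrite IH /= ffunE.
Qed.

Lemma acts_fixed s p : (acts s p == p) =
  [forall x, val p x \in sorted_orders (lex_key (related_sets s)) (children (val x))].
Proof.
have lin x := forallP (valP p) x.
apply/eqP/forallP => [fix_p x | fix_p].
  by rewrite -moves_to_front_fixed // -acts_val fix_p.
apply/val_inj/ffunP=> x; rewrite acts_val; apply/eqP.
by rewrite moves_to_front_fixed.
Qed.

Lemma compatibleP a E :
  reflect (forall x B, B \in val a x -> {in B &, forall y z, related E y = related E z})
    (compatible a E).
Proof.
have split_x x := refines_split [set y | related E y] (forallP (valP a) x).
have relE x : related_partition E (val x) =
    [set [set y in children (val x) | y \in [set y | related E y]];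
         [set y in children (val x) | y \notin [set y | related E y]]] :\ set0.
  by congr ([set _; _] :\ _); apply/setP=> y; rewrite !inE.
apply: (iffP forallP) => [ca x B BP y z yB zB | ca x].
  have := ca x; rewrite relE => /split_x/(_ B BP y z yB zB).
  by rewrite !inE.
by rewrite relE; apply/split_x=> B BP y z yB zB; rewrite !inE (ca x B BP y z).
Qed.

Lemma all_compatible a s :
  all (compatible a) s =
  [forall x, key_constant (lex_key (related_sets s)) (val a x)].
Proof.
apply/allP/forallP => [ca x | ca E Es].
  apply/'forall_in_'forall_in_'forall_in_eqP => B BP y yB z zB.
  apply/eqP/lex_key_eqP => U /mapP[E Es ->]; rewrite !inE.
  exact: (compatibleP _ _ (ca E Es) x B).
apply/compatibleP => x B BP y z yB zB.
move/'forall_in_'forall_in_'forall_in_eqP: (ca x) => /(_ B BP y yB z zB)/eqP.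
move/lex_key_eqP => /(_ [set y | related E y]); rewrite !inE; apply.
exact: map_f.
Qed.

(** Being fixed is a separate condition at each inner node, so the count is a product over nodes.
    Each factor is a sum over partitions, and distributivity turns the product of sums into a sum
    over families of partitions. *)
Lemma card_acts_fixed s :
  #|[set p | acts s p == p]| = (\sum_(a | all (compatible a) s) walk_multiplicity a)%N.
Proof.
pose k := lex_key (related_sets s).
transitivity (\prod_(x : inner T) #|sorted_orders k (children (val x))|)%N.
  under [RHS]eq_bigr do rewrite -sum1_card.
  rewrite bigA_distr_big_dep -sum1_card.
  under [RHS]eq_bigr do rewrite big1_eq.
  transitivity (\sum_(f : {ffun inner T -> {set T * T}} |
     [forall x : inner T, linear_order (children (val x)) (f x)] &&
     [forall x : inner T, f x \in sorted_orders k (children (val x))]) 1)%N.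
    rewrite (big_sub_cond (fun f : {ffun inner T -> {set T * T}} =>
      [forall x : inner T, linear_order (children (val x)) (f x)])) /=.
    by apply: eq_bigl => p; rewrite inE acts_fixed.
  apply: eq_bigl => f; apply/andP/familyP => [[_ /forallP] // | fS].
  split; last exact/forallP.
  by apply/forallP=> x; have /sorted_ordersP[] := fS x.
rewrite (eq_bigr _ (fun x _ => card_sorted_orders_partitions (lex_key_lt _) _)).
rewrite bigA_distr_big_dep.
transitivity (\sum_(f : {ffun inner T -> {set {set T}}} |
   [forall x : inner T, partition (f x) (children (val x))] &&
   [forall x, key_constant k (f x)])
   \prod_(x : inner T) \prod_(B in f x) (#|B|.-1)`!)%N.
  apply: eq_bigl => f; apply/familyP/andP => [fS | [/forallP f1 /forallP f2] x].
    by split; apply/forallP=> x; have /andP[] := fS x.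
  by apply/andP.
rewrite (big_sub_cond (fun f : {ffun inner T -> {set {set T}}} =>
   [forall x : inner T, partition (f x) (children (val x))])) /=.
by apply: eq_bigl => a; rewrite all_compatible.
Qed.

(* [E] does not separate more than [s]: then an [E] applied before [s] has no
   effect. *)
Definition cpt s E :=
  [forall x : inner T, forall y in children (val x), forall z in children (val x),
    (lex_key (related_sets s) y == lex_key (related_sets s) z) ==>
    (related E y == related E z)].

Lemma cptP s E :
  reflect (forall x : inner T, {in children (val x) &, forall y z,
      lex_key (related_sets s) y = lex_key (related_sets s) z ->
      related E y = related E z})
    (cpt s E).
Proof.
apply: (iffP forallP) => [cE x y z yx zx /eqP eqk | cE x].
  move/'forall_in_'forall_in_implyP: (cE x) => /(_ y yx z zx eqk).
  by move/eqP.
apply/'forall_in_'forall_in_implyP=> y yx z zx /eqP eqk; apply/eqP.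
exact: (cE x).
Qed.

(** The original order matters only between elements of equal key, and on those relatedness to [E]
    is constant, so the move by [E] leaves their order alone. *)
Lemma acts_cpt s E p : cpt s E -> acts (E :: s) p = acts s p.
Proof.
move=> cE; rewrite -[acts (E :: s) p]/(acts s (act E p)).
have lin (q : local_ordering T) x := linear_order_subset (forallP (valP q) x).
apply/val_inj/ffunP=> x; apply/setP=> -[y z].
rewrite !acts_val !in_moves_to_front ?lin // /= ffunE.
case yx: (y \in children _) => //=; case zx: (z \in children _) => //=.
congr (_ || _); case: eqP => //= eqk.
by rewrite in_set in_setX /= yx zx !in_set (cptP _ _ cE x y z yx zx eqk) eqxx.
Qed.

Lemma cpt_cons s E1 E2 : cpt s E2 -> cpt (E1 :: s) E2.
Proof.
move=> /cptP c2; apply/cptP=> x y z yx zx /eqP/lex_key_eqP eqk.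
apply: (c2 x y z yx zx); apply/eqP/lex_key_eqP => U Us; apply: eqk.
by rewrite inE Us orbT.
Qed.

Lemma cpt_head s E : cpt (E :: s) E.
Proof.
apply/cptP=> x y z yx zx /eqP/lex_key_eqP/(_ [set y | related E y]).
by rewrite !inE eqxx; apply.
Qed.

Definition key_partition_family s : {ffun inner T -> {set {set T}}} :=
  [ffun x => preim_partition (lex_key (related_sets s)) (children (val x))].

Lemma key_partition_partition s :
  [forall x, partition (key_partition_family s x) (children (val x))].
Proof. by apply/forallP=> x; rewrite ffunE preim_partitionP. Qed.

Definition key_partition s : local_partition T :=
  exist _ (key_partition_family s) (key_partition_partition s).

(** This identifies the weight of the sets that do not separate more than [s] with the eigenvalue of
    a partition, here the one into classes of equal key. *)
Lemma cpt_key_partition s E : cpt s E = compatible (key_partition s) E.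
Proof.
apply/cptP/compatibleP => [cE x B | cE x y z yx zx eqk].
  rewrite /= ffunE => /imsetP[c cx ->] y z.
  rewrite in_set => /andP[yx /eqP ky]; rewrite in_set => /andP[zx /eqP kz].
  by apply: (cE x) => //; rewrite -ky -kz.
pose B := [set b in children (val x) |
  lex_key (related_sets s) y == lex_key (related_sets s) b].
apply: (cE x B); rewrite ?[_ \in B]in_set ?yx ?zx /= ?eqk //.
by rewrite ffunE; apply/imsetP; exists y.
Qed.

Lemma walk_multiplicity_gt0 a : (0 < walk_multiplicity a)%N.
Proof. by rewrite !prodn_gt0 // => x; rewrite prodn_gt0 // => B; rewrite fact_gt0. Qed.

(** The empty word fixes every ordering, so the number of orderings is a sum of positive
    multiplicities over a nonempty index set. *)
Lemma local_ordering_gt0 : (0 < #|local_ordering T|)%N.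
Proof.
have <- : #|[set p | acts [::] p == p]| = #|local_ordering T|.
  by apply: eq_card => p; rewrite inE /= eqxx.
rewrite card_acts_fixed (bigD1 (key_partition [::])) //=.
by rewrite ltn_addr // walk_multiplicity_gt0.
Qed.

(** * Matrices of the composite actions *)

Variable R : realType.

Definition acts_matrix s : 'M[R]_#|local_ordering T| :=
  \matrix_(i, j) (acts s (enum_val i) == enum_val j)%:R.

Lemma acts_matrix_nil : acts_matrix [::] = 1%:M.
Proof. by apply/matrixP=> i j; rewrite !mxE (inj_eq enum_val_inj). Qed.

Lemma acts_matrix_cpt s E : cpt s E -> acts_matrix (E :: s) = acts_matrix s.
Proof. by move=> sE; apply/matrixP=> i j; rewrite !mxE acts_cpt. Qed.

Lemma trace_acts_matrix s :
  \tr (acts_matrix s) = (\sum_(a | all (compatible a) s) walk_multiplicity a)%:R.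
Proof.
rewrite -card_acts_fixed -sum1_card natr_sum big_mkcond /=.
rewrite (reindex (@enum_val _ (local_ordering T))) /=; last exact/onW_bij/enum_val_bij.
by apply: eq_bigr => i _; rewrite mxE inE; case: eqP.
Qed.

(** Extension by zero lets sums run over all of [{set T}], and makes the weights nonnegative
    everywhere once they are so on leaf sets. *)
Definition leaf_weight (w : {set T} -> R) E : R :=
  if E \in powerset (leaves T) then w E else 0.

(** Rows are indexed by the starting ordering, so in this product the step of the walk precedes the
    word [s], and its set becomes the head. *)
Lemma transition_acts_matrix w s :
  transition_matrix w *m acts_matrix s = \sum_E leaf_weight w E *: acts_matrix (E :: s).
Proof.
apply/matrixP=> i j; rewrite !mxE summxE.
under eq_bigr do rewrite !mxE /transition big_mkcondr mulr_suml.
rewrite exchange_big big_mkcond /=; apply: eq_bigr => E _.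
rewrite !mxE /leaf_weight; case: ifP => _; last by rewrite mul0r.
rewrite (bigD1 (enum_rank (act E (enum_val i)))) //= enum_rankK eqxx.
rewrite big1 ?addr0 // => k nk; case: eqP => [eqk | _]; last by rewrite mul0r.
by rewrite eqk enum_valK eqxx in nk.
Qed.

Lemma walk_eigenvalueE w a :
  walk_eigenvalue w a = \sum_(E | compatible a E) leaf_weight w E.
Proof. by rewrite /walk_eigenvalue big_mkcondl. Qed.

End TreeWalk.

Theorem theorem2p6 (R : realType) (T : rooted_tree) (w : {set T} -> R)
    (pureT : pure T) (w_prob : probability_on_leaf_sets w) :
  [/\ diagonalizable (transition_matrix w),
      forall a : local_partition T,
        eigenvalue (transition_matrix w) (walk_eigenvalue w a),
      forall l : R,
        mup l (char_poly (transition_matrix w)) =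
          (\sum_(a : local_partition T | walk_eigenvalue w a == l)
             walk_multiplicity a)%N &
      forall l : R, eigenvalue (transition_matrix w) l ->
        exists a : local_partition T, l = walk_eigenvalue w a].
Proof.
have w_ge0 E : 0 <= leaf_weight w E.
  by rewrite /leaf_weight; case: ifP => // EL; case: w_prob => w_ge0 _; apply: w_ge0.
have [diagP mupP] := walk_spectrum (local_ordering_gt0 T) w_ge0
  (acts_matrix_nil T R) (transition_acts_matrix w) (@trace_acts_matrix T R)
  (@acts_matrix_cpt T R) (@cpt_cons T) (@cpt_head T)
  (fun s => ex_intro _ (key_partition s) (cpt_key_partition s)).
have mup_eigen l : mup l (char_poly (transition_matrix w)) =
    (\sum_(a : local_partition T | walk_eigenvalue w a == l) walk_multiplicity a)%N.
  by rewrite mupP; apply: eq_bigl => a; rewrite walk_eigenvalueE.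
have eigen_mup l : eigenvalue (transition_matrix w) l =
    (0 < mup l (char_poly (transition_matrix w)))%N.
  rewrite eigenvalue_root_char -XsubC_dvd ?monic_neq0 ?char_poly_monic //.
  by rewrite dvdp_XsubCl.
(* All [walk_multiplicity a] are positive, so the multiplicity at [l] is positive exactly when [l]
   is some [walk_eigenvalue w a]. *)
split=> // [a | l]; rewrite eigen_mup mup_eigen.
  by rewrite (bigD1 a) //= ltn_addr // walk_multiplicity_gt0.
rewrite lt0n sum_nat_eq0 negb_forall => /existsP[a].
by rewrite negb_imply => /andP[/eqP<- _]; exists a.
Qed.
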